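(* Let $(\Omega,\Sigma,\mu)$ be a $\sigma$-finite measure space and let $K\subset L^1(\mu)$ be nonempty, bounded, closed, convex, and measure-compact. Then every nonexpansive map $T:K\to K$ has a fixed point.
   Context: $\|\cdot\|_1$ denotes the $L^1(\mu)$-norm; ''bounded'' and ''closed'' refer to this norm. A map $T:K\to K$ is nonexpansive if $\|T(x)-T(y)\|_1\le\|x-y\|_1$ for all $x,y\in K$. On a $\sigma$-finite measure space, a sequence $(f_n)$ converges locally in measure to $f$ if for every $E\in\Sigma$ with $\mu(E)<\infty$ and every $\varepsilon>0$, $\mu(\{x\in E:|f_n(x)-f(x)|>\varepsilon\})\to0$. A set $K\subset L^1(\mu)$ is measure-compact if it is compact for the topology of local convergence in measure. *)

(* Defs.v *)
From HB Require Import structures.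
From mathcomp Require Import all_boot all_order all_algebra.
From mathcomp Require Import all_classical all_reals all_analysis measurable_realfun.
Set Implicit Arguments.
Unset Strict Implicit.
Unset Printing Implicit Defensive.
Import Order.TTheory GRing.Theory Num.Theory.
Import numFieldNormedType.Exports.

Local Open Scope classical_set_scope.
Local Open Scope ring_scope.

(* [LspaceType1 mu] is the quotient of the integrable functions by a.e.
   equality, but the library leaves it without any algebraic structure; [L1 mu]
   is a copy carrying the vector space structure inherited from
   [LfunType mu] and the norm 'N[mu]_1. *)
Definition L1 (d : measure_display) (T : measurableType d) (R : realType)
  (mu : {measure set T -> \bar R}) : Type := LspaceType1 mu.

Section L1_quotient.
Context (d : measure_display) (T : measurableType d) (R : realType).
Variable mu : {measure set T -> \bar R}.

Notation Lf := (LfunType mu (@lexx _ _ 1%E)).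

(* A representative of the class; only its a.e. class is meaningful. *)
Definition L1_fun (f : L1 mu) : T -> R := (f : LspaceType1 mu).

Lemma L1_funP (f : L1 mu) : L1_fun f \in Lfun mu 1.
Proof.
case: f => f [[ff]]; apply/andP; split; rewrite inE//=.
exact: (@measurable_funPT _ _ _ _ (repr f)).
Qed.

Definition L1_repr (f : L1 mu) : Lf := Lfun_Sub (@lexx _ _ 1%E) (L1_funP f).

Definition mfun_of_Lfun (g : Lf) : {mfun T >-> measurableTypeR R} :=
  HB.pack (g : T -> R) (isMeasurableFun.Build d _ T (measurableTypeR R) g
    (@measurable_funPT _ _ _ _ g)).

Definition L1_class (g : Lf) : {mfun_ mu, T >-> measurableTypeR R} :=
  (\pi_({mfun_ mu, T >-> measurableTypeR R}) (mfun_of_Lfun g))%qT.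

Lemma L1_classE (g : Lf) : L1_class g = g %[ae mu].
Proof. by have /eqmodP/asboolP := reprK (L1_class g). Qed.

Lemma ae_eq_Lnorm1 (f g : T -> R) : measurable_fun setT f ->
  measurable_fun setT g -> f = g %[ae mu] ->
  ('N[mu]_1[EFin \o f] = 'N[mu]_1[EFin \o g])%E.
Proof.
move=> mf mg fg; rewrite !Lnorm1; apply: ae_eq_integral => //.
- by apply: measurableT_comp => //; exact/measurable_EFinP.
- by apply: measurableT_comp => //; exact/measurable_EFinP.
- by apply: filterS fg => x /(_ I) + _ => /= ->.
Qed.

Lemma L1_class_finite (g : Lf) : finite_norm mu 1 (L1_class g).
Proof.
rewrite /finite_norm (@ae_eq_Lnorm1 _ g)//; last exact: L1_classE.
- exact: (Lfunction_finite _ g).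
- exact: (@measurable_funPT _ _ _ _ (repr (L1_class g))).
Qed.

Definition L1_pi (g : Lf) : L1 mu :=
  HB.pack_for (LspaceType1 mu) (L1_class g)
    (isFinLebesgue.Build d T R mu _ (@lexx _ _ 1%E) (L1_class g)
       (L1_class_finite g)).

Lemma L1_piE (g : Lf) : L1_repr (L1_pi g) = g %[ae mu].
Proof. exact: L1_classE. Qed.

Lemma L1_ext (f g : L1 mu) : L1_repr f = L1_repr g %[ae mu] -> f = g.
Proof.
case: f g => [f [[pf]]] [g [[pg]]] fg.
have efg : f = g.
  rewrite -[f]reprK -[g]reprK; apply/eqmodP/asboolP; exact: fg.
by subst g; rewrite (Prop_irrelevance pf pg).
Qed.

Lemma L1_reprK (f : L1 mu) : L1_pi (L1_repr f) = f.
Proof. exact/L1_ext/L1_piE. Qed.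

Lemma L1_pi_eq (f g : Lf) : f = g %[ae mu] -> L1_pi f = L1_pi g.
Proof.
move=> fg; apply: L1_ext.
by apply: filterS3 (L1_piE f) (L1_piE g) fg => x fE gE e /[dup] /fE -> /[dup] /gE -> /e.
Qed.

HB.instance Definition _ := gen_eqMixin (L1 mu).
HB.instance Definition _ := gen_choiceMixin (L1 mu).

Definition L1_zero : L1 mu := L1_pi 0.
Definition L1_opp (f : L1 mu) := L1_pi (- L1_repr f).
Definition L1_add (f g : L1 mu) := L1_pi (L1_repr f + L1_repr g).
Definition L1_scale (a : R) (f : L1 mu) := L1_pi (a *: L1_repr f).
Definition L1_norm (f : L1 mu) : R := fine ('N[mu]_1[EFin \o L1_fun f])%E.

Lemma L1_pi_opp f : L1_opp (L1_pi f) = L1_pi (- f).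
Proof.
apply: L1_pi_eq; apply: filterS (L1_piE f) => x /[apply] fE.
exact: (congr1 -%R fE).
Qed.

Lemma L1_pi_add f g : L1_add (L1_pi f) (L1_pi g) = L1_pi (f + g).
Proof.
apply: L1_pi_eq; apply: filterS2 (L1_piE f) (L1_piE g) => x.
by move=> fE gE Tx; exact: (congr2 +%R (fE Tx) (gE Tx)).
Qed.

Lemma L1_pi_scale a f : L1_scale a (L1_pi f) = L1_pi (a *: f).
Proof.
apply: L1_pi_eq; apply: filterS (L1_piE f) => x /[apply] fE.
exact: (congr1 ( *%R a) fE).
Qed.

Lemma L1_pi_norm f : L1_norm (L1_pi f) = fine ('N[mu]_1[EFin \o f])%E.
Proof.
congr fine; apply: ae_eq_Lnorm1 => //; last exact: L1_piE.
exact: (@measurable_funPT _ _ _ _ (L1_repr (L1_pi f))).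
Qed.

Lemma L1_addA : associative L1_add.
Proof.
move=> f g h; rewrite -[f]L1_reprK -[g]L1_reprK -[h]L1_reprK.
by rewrite !L1_pi_add addrA.
Qed.

Lemma L1_addC : commutative L1_add.
Proof. by move=> f g; rewrite /L1_add addrC. Qed.

Lemma L1_add0 : left_id L1_zero L1_add.
Proof. by move=> f; rewrite -[f]L1_reprK L1_pi_add add0r. Qed.

Lemma L1_addN : left_inverse L1_zero L1_opp L1_add.
Proof. by move=> f; rewrite -[f]L1_reprK L1_pi_opp L1_pi_add addNr. Qed.

HB.instance Definition _ :=
  GRing.isZmodule.Build (L1 mu) L1_addA L1_addC L1_add0 L1_addN.

Lemma L1_scaleA a b f : L1_scale a (L1_scale b f) = L1_scale (a * b) f.
Proof. by rewrite -[f]L1_reprK !L1_pi_scale scalerA. Qed.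

Lemma L1_scale1 : left_id 1 L1_scale.
Proof. by move=> f; rewrite -[f]L1_reprK !L1_pi_scale scale1r. Qed.

Lemma L1_scaleDr : right_distributive L1_scale +%R.
Proof.
move=> a f g; rewrite -[f]L1_reprK -[g]L1_reprK.
transitivity (L1_pi (a *: (L1_repr f + L1_repr g))).
  by rewrite -L1_pi_scale -L1_pi_add.
by rewrite !L1_pi_scale scalerDr -L1_pi_add.
Qed.

Lemma L1_scaleDl f : {morph L1_scale^~ f : a b / a + b}.
Proof.
by move=> a b; rewrite -[f]L1_reprK !L1_pi_scale scalerDl -L1_pi_add.
Qed.

HB.instance Definition _ := GRing.Zmodule_isLmodule.Build R (L1 mu)
  L1_scaleA L1_scale1 L1_scaleDr L1_scaleDl.

Lemma L1_normD (f g : L1 mu) : L1_norm (f + g) <= L1_norm f + L1_norm g.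
Proof.
rewrite -[f]L1_reprK -[g]L1_reprK.
rewrite (_ : L1_pi _ + L1_pi _ = L1_pi (L1_repr f + L1_repr g)); last first.
  exact: L1_pi_add.
rewrite !L1_pi_norm; exact: ler_LnormD.
Qed.

Lemma L1_normZ a (f : L1 mu) : L1_norm (a *: f) = `|a| * L1_norm f.
Proof.
rewrite -[f]L1_reprK.
rewrite (_ : a *: L1_pi _ = L1_pi (a *: L1_repr f)); last exact: L1_pi_scale.
rewrite !L1_pi_norm.
apply: EFin_inj; rewrite EFinM !finite_norm_fine; exact: LnormZ.
Qed.

Lemma L1_norm0_eq0 (f : L1 mu) : L1_norm f = 0 -> f = 0.
Proof.
rewrite -[f]L1_reprK L1_pi_norm => /fine_Lnormr_eq0 f0.
exact: L1_pi_eq.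
Qed.

HB.instance Definition _ := Lmodule_isNormed.Build R (L1 mu)
  L1_normD L1_normZ L1_norm0_eq0.

Lemma L1_normE (f : L1 mu) : `|f| = fine (\int[mu]_x `|L1_fun f x|%:E)%E.
Proof. by rewrite -[LHS]/(L1_norm f) /L1_norm Lnorm1. Qed.

End L1_quotient.

(* The same set endowed with the uniformity of local convergence in measure,
   generated by the entourages
   {(f, g) | mu {x in E | |f x - g x| > e} < e}, mu E < +oo, e > 0. *)
Definition L1_meas (d : measure_display) (T : measurableType d) (R : realType)
  (mu : {measure set T -> \bar R}) : Type := L1 mu.

Section measure_topology.
Context (d : measure_display) (T : measurableType d) (R : realType).
Variable mu : {measure set T -> \bar R}.

HB.instance Definition _ := Choice.copy (L1_meas mu) (L1 mu).

Definition dev_set (f g : L1 mu) (E : set T) (e : R) : set T :=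
  [set x | E x /\ e < `|L1_fun f x - L1_fun g x|].

Lemma measurable_dev_set f g E e : measurable E -> measurable (dev_set f g E e).
Proof.
move=> mE.
have mf (h : L1 mu) : measurable_fun E (L1_fun h).
  apply: measurable_funTS.
  exact: (@measurable_funPT _ _ _ _ (L1_repr h)).
have -> : dev_set f g E e =
    E `&` (fun x => `|L1_fun f x - L1_fun g x|) @^-1` `]e, +oo[.
  by apply/seteqP; split=> x /=; rewrite in_itv/= andbT.
by apply: (measurableT_comp (@normr_measurable R setT)) => //;
  exact: measurable_funB.
Qed.

Definition meas_entourage_dom : set (set T * R) :=
  [set Ee | [/\ measurable Ee.1, (mu Ee.1 < +oo)%E & 0 < Ee.2]].

Definition meas_entourage_base (Ee : set T * R) : set (L1 mu * L1 mu) :=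
  [set fg | (mu (dev_set fg.1 fg.2 Ee.1 Ee.2) < Ee.2%:E)%E].

Definition meas_entourage : set_system (L1_meas mu * L1_meas mu) :=
  filter_from meas_entourage_dom meas_entourage_base.

Lemma meas_entourage_filter : Filter meas_entourage.
Proof.
apply: filter_from_filter; first by exists (set0, 1); split=> //=; rewrite measure0.
move=> [E e] [F r] [/= mE Ey e0] [/= mF Fy r0].
exists (E `|` F, Num.min e r).
  split => /=; [exact: measurableU| |by rewrite lt_min e0].
  by rewrite (le_lt_trans (measureU2 _ _ _))// lte_add_pinfty.
move=> [f g]; rewrite /meas_entourage_base/= => fg.
split => /=.
- rewrite (le_lt_trans _ (lt_le_trans fg _)) ?lee_fin ?ge_min ?lexx//.
  apply: le_measure; rewrite ?inE; try exact/measurable_dev_set/measurableU;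
    try exact: measurable_dev_set.
  by move=> x [Ex ex]; split; [left|rewrite (le_lt_trans _ ex)// ge_min lexx].
- rewrite (le_lt_trans _ (lt_le_trans fg _)) ?lee_fin ?ge_min ?lexx ?orbT//.
  apply: le_measure; rewrite ?inE; try exact/measurable_dev_set/measurableU;
    try exact: measurable_dev_set.
  by move=> x [Ex ex]; split; [right|rewrite (le_lt_trans _ ex)// ge_min lexx orbT].
Qed.

Local Open Scope relation_scope.

Lemma meas_entourage_diagonal A : meas_entourage A -> diagonal `<=` A.
Proof.
move=> [[E e] [/= mE Ey e0]] EA [f g]/= fg; apply: EA => /=.
have {fg} -> : f = g by exact: fg.
rewrite /meas_entourage_base/= (_ : dev_set _ _ _ _ = set0) ?measure0//.
by apply/seteqP; split=> x //= [_]; rewrite subrr normr0 ltNge ltW.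
Qed.

Lemma meas_entourage_inv A : meas_entourage A -> meas_entourage A^-1.
Proof.
move=> [[E e] domE EA]; exists (E, e) => // -[f g]/= fg; apply: EA.
move: fg; rewrite /meas_entourage_base/= (_ : dev_set f g E e = dev_set g f E e)//.
by apply/seteqP; split=> x [Ex ex]; split=> //; rewrite distrC.
Qed.

Lemma meas_entourage_split A : meas_entourage A ->
  exists2 B, meas_entourage B & B \; B `<=` A.
Proof.
move=> [[E e] [/= mE Ey e0]] EA.
exists (meas_entourage_base (E, e / 2)).
  by exists (E, e / 2) => //; split=> //=; rewrite divr_gt0.
move=> [f h] [g/= fg gh]; apply: EA; rewrite /meas_entourage_base/=.
rewrite (@le_lt_trans _ _ (mu (dev_set f g E (e / 2) `|` dev_set g h E (e / 2))))//.
  apply: le_measure; rewrite ?inE; [exact: measurable_dev_set|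
    by apply: measurableU; exact: measurable_dev_set|].
  move=> x [Ex ex]; have [fgx|fgx] := ltP (e / 2) `|L1_fun f x - L1_fun g x|.
    by left.
  right; split=> //; rewrite ltNge; apply/negP => ghx.
  have := lt_le_trans ex (ler_distD (L1_fun g x) _ _).
  by apply/negP; rewrite -leNgt [leRHS]splitr lerD.
rewrite (le_lt_trans (measureU2 _ _ _))//; [exact: measurable_dev_set..|].
by rewrite [ltRHS](_ : _ = (e / 2)%:E + (e / 2)%:E)%E ?lteD// -EFinD -splitr.
Qed.

HB.instance Definition _ := isUniform.Build (L1_meas mu)
  meas_entourage_filter meas_entourage_diagonal meas_entourage_inv
  meas_entourage_split.

Local Close Scope relation_scope.

Let ge0_cvge0P (v : (\bar R)^nat) : (forall n, 0 <= v n)%E ->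
  v n @[n --> \oo] --> 0%E <->
  forall r : R, 0 < r -> \forall n \near \oo, (v n < r%:E)%E.
Proof.
move=> v0; split.
  move/fine_cvgP => [finv /cvgrPdist_lt cv] r r0.
  apply: filterS2 finv (cv _ r0) => n vn.
  by rewrite sub0r normrN /= ger0_norm ?fine_ge0// -lte_fin fineK.
move=> cv; apply/fine_cvgP; split.
  apply: filterS (cv 1 ltr01) => n vn.
  by rewrite ge0_fin_numE// (lt_trans vn)// ltry.
apply/cvgrPdist_lt => r r0; apply: filterS (cv r r0) => n vn.
rewrite sub0r normrN /= ger0_norm ?fine_ge0// -lte_fin fineK//.
by rewrite ge0_fin_numE// (lt_trans vn)// ltry.
Qed.

(* The convergent sequences of this uniformity are exactly those converging
   locally in measure. *)
Lemma cvg_measP (u : (L1_meas mu)^nat) (f : L1_meas mu) :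
  u @ \oo --> f <->
  forall E, measurable E -> (mu E < +oo)%E -> forall e : R, 0 < e ->
    mu [set x | E x /\ e < `|L1_fun (u n) x - L1_fun f x|] @[n --> \oo] --> 0%E.
Proof.
split=> [uf E mE Ey e e0|uf A].
  apply/ge0_cvge0P => // r r0.
  pose U := meas_entourage_base (E, Num.min e r).
  have entU : meas_entourage U.
    by exists (E, Num.min e r) => //; split=> //=; rewrite lt_min e0.
  have fU : nbhs f (xsection U f) by exact: (@nbhs_entourage (L1_meas mu)).
  have uU : \forall n \near \oo, xsection U f (u n) := uf _ fU.
  apply: filterS uU => n /= /xsectionP; rewrite /U/meas_entourage_base/=.
  move=> fun_; rewrite (le_lt_trans _ (lt_le_trans fun_ _)) ?lee_fin ?ge_min ?lexx ?orbT//.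
  apply: le_measure; rewrite ?inE; [exact: measurable_dev_set..|].
  by move=> x [Ex ex]; split=> //; rewrite distrC (le_lt_trans _ ex)// ge_min lexx.
rewrite -nbhs_entourageE => -[U [[E e] [/= mE Ey e0]] EU UA].
have := uf E mE Ey e e0 => /ge0_cvge0P => /(_ (fun=> measure_ge0 _ _)) /(_ e e0).
apply: filterS => n une; apply: UA; apply/xsectionP/EU => /=.
rewrite /meas_entourage_base/= (_ : dev_set _ _ _ _ = dev_set (u n) f E e)//.
by apply/seteqP; split=> x [Ex ex]; split=> //; rewrite distrC.
Qed.

End measure_topology.

Definition measure_compact (d : measure_display) (T : measurableType d)
    (R : realType) (mu : {measure set T -> \bar R}) (K : set (L1 mu)) : Prop :=
  compact (K : set (L1_meas mu)).

(* Main.v *)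
Require Import Defs.
From HB Require Import structures.
From mathcomp Require Import all_boot all_order all_algebra.
From mathcomp Require Import all_classical all_reals all_analysis.
From mathcomp Require Import measurable_realfun.
From mathcomp Require Import ring lra.

(** The map T has approximate fixed points: there are x in K making |T x - x|
arbitrarily small ([approx_fixed_point]). Measure-compactness makes these
accumulate, in measure, at some f in K, and f is a fixed point because of a
rigidity of the L^1 norm: if y is close to f in measure then, for every fixed g,
the distance from y to g is almost |y - f| + |f - g|. With g = T f this reads

  |f - T f| + |y - f| <= |y - T f| + small
                      <= |y - T y| + |T y - T f| + small
                      <= small + |y - f| + small,

so |f - T f| is as small as desired.

The rigidity comes from the pointwise inequality
|f - g| + |f - y| <= |y - g| + 2 min(|f - g|, |f - y|), which integrates to
[L1_dist_defect]: the defect in the triangle inequality is controlled by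
the integral of min(|f - g|, |f - y|). That integral is small on a neighbourhood
of f for convergence in measure ([near_meas_min_lt]), since a truncated
difference is dominated by the fixed integrable function |f - g|, which lives,
up to a small integral, on a set of finite measure where it is bounded
([integrable_tail]). As all these statements are about neighbourhoods, a cluster
point of a filter suffices and no convergent subsequence has to be extracted. *)

Set Implicit Arguments.
Unset Strict Implicit.
Unset Printing Implicit Defensive.
Import Order.TTheory GRing.Theory Num.Theory.
Import numFieldNormedType.Exports.

Local Open Scope classical_set_scope.
Local Open Scope ring_scope.

(** * Approximate fixed points of nonexpansive maps *)

(** The contractions x |-> t x0 + (1 - t) T x preserve K and are uniformly close
to T when t is small. Completeness is avoided: successive iterates
of a contraction get arbitrarily close to each other, so a late iterate is
already an approximate fixed point. *)
Lemma approx_fixed_point (R : realType) (V : normedModType R) (K : set V)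
    (T : V -> V) (e : R) :
  K !=set0 -> bounded_set K -> convex_set K -> set_fun K K T ->
  (forall x y, K x -> K y -> `|T x - T y| <= `|x - y|) -> 0 < e ->
  exists2 x, K x & `|T x - x| < e.
Proof.
move=> [x0 Kx0] /(@ex_bound _ _ _ _ _ (globally_properfilter Kx0))[M KM] cK TK Tne e0.
have dK x y : K x -> K y -> `|x - y| <= 2 * M.
  move=> Kx Ky; rewrite (le_trans (ler_normB _ _))// [leRHS]mulr_natl mulr2n.
  by rewrite lerD// KM.
have M0 : 0 <= M by rewrite (le_trans _ (KM _ Kx0)).
(* With 2 M + 1 in place of the bound 2 M on the diameter, t stays meaningful
   for M = 0 and t * (2 M) is strictly below e / 2. *)
pose t := Num.min 1 (e / (2 * (2 * M + 1))).
have t0 : 0 < t by rewrite lt_min ltr01 divr_gt0//; lra.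
have t1 : t <= 1 by rewrite ge_min lexx.
have te : t * (2 * M) < e / 2.
  apply: (@le_lt_trans _ _ (e / (2 * (2 * M + 1)) * (2 * M))).
    by rewrite ler_wpM2r ?ge_min ?lexx ?orbT//; lra.
  have -> : e / (2 * (2 * M + 1)) * (2 * M) = e / 2 * (2 * M / (2 * M + 1)).
    by field; lra.
  by rewrite gtr_pMr ?divr_gt0// ltr_pdivrMr; lra.
pose S x := t *: x0 + (1 - t) *: T x.
have SK x : K x -> K (S x).
  move=> Kx; apply/set_mem.
  apply: (cK x0 (T x) (Itv01 (ltW t0) t1)); apply/mem_set => //.
  exact: TK.
have Sx x y : K x -> K y -> `|S x - S y| <= (1 - t) * `|x - y|.
  move=> Kx Ky; rewrite opprD addrACA subrr add0r -scalerBr normrZ.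
  by rewrite ger0_norm ?subr_ge0// ler_wpM2l ?subr_ge0// Tne.
have ST x : K x -> `|T x - S x| <= t * (2 * M).
  move=> Kx; have -> : T x - S x = t *: (T x - x0).
    by rewrite /S scalerBl scale1r scalerBr addrCA opprD addrA subrr add0r opprB.
  by rewrite normrZ gtr0_norm// ler_wpM2l ?(ltW t0)// dK//; exact: TK.
pose u n := iter n S x0.
have uK n : K (u n) by elim: n => //= n; exact: SK.
have Su n : `|S (u n) - u n| <= (1 - t) ^+ n * (2 * M).
  elim: n => [|n IH]; first by rewrite expr0 mul1r dK//; exact: SK.
  rewrite exprS -mulrA (le_trans (Sx (S (u n)) (u n) (uK n.+1) (uK n)))//.
  by rewrite ler_wpM2l// subr_ge0.
have cv : (1 - t) ^+ n * (2 * M) @[n --> \oo] --> (0 : R).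
  rewrite -[0](mul0r (2 * M)); apply: cvgMl; apply: cvg_expr.
  by rewrite ger0_norm ?subr_ge0// ltrBlDr ltrDl.
have /cvgrPdist_lt/(_ (e / 2)) := cv.
case; first by rewrite divr_gt0.
move=> N _ /(_ N (leqnn N)); rewrite sub0r normrN => /(le_lt_trans (ler_norm _)) N2.
exists (u N) => //; rewrite -(subrKA (S (u N))).
rewrite (le_lt_trans (ler_normD _ _))// [ltRHS]splitr ltrD//.
  exact: le_lt_trans (ST _ (uK N)) te.
exact: le_lt_trans (Su N) N2.
Qed.

(** * Integrable functions and truncation *)

(** The sets where 1/(n+1) <= |h| <= n+1 have finite measure by Markov's
inequality and increase to the set where h does not vanish, so dominated
convergence makes the integral of |h| off one of them smaller than e. *)
Lemma integrable_tail d (T : measurableType d) (R : realType)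
    (mu : {measure set T -> \bar R}) (h : T -> R) (e : R) :
  mu.-integrable setT (EFin \o h) -> 0 < e ->
  exists E M, [/\ measurable E, (mu E < +oo)%E, 0 <= M,
    forall x, E x -> `|h x| <= M &
    (\int[mu]_(x in ~` E) `|h x|%:E < e%:E)%E].
Proof.
move=> /[dup] ih /integrableP[/measurable_EFinP mh hoo] e0.
have mhn : measurable_fun setT (fun x => `|h x|).
  exact: measurableT_comp.
pose E n := [set x | n.+1%:R^-1 <= `|h x| <= n.+1%:R].
have mE n : measurable (E n).
  have -> : E n = setT `&` (fun x => `|h x|) @^-1` `[n.+1%:R^-1, n.+1%:R].
    by apply/seteqP; split => x /=; rewrite ?in_itv/=; [|case].
  exact: mhn.
have Eoo n : (mu (E n) < +oo)%E.
  have := @le_integral_abse _ _ _ mu (E n) (mE n) _ (n.+1%:R^-1)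
    (measurable_funTS (measurable_int _ ih)).
  rewrite invr_gt0 ltr0n => /(_ isT); rewrite (_ : _ `&` _ = E n); last first.
    by apply/setIidl => x /= /andP[+ _]; rewrite lee_fin.
  have mh1 : measurable_fun setT (fun x => `|(EFin \o h) x|%E).
    by apply: measurableT_comp => //; exact: measurable_int ih.
  move=> /le_lt_trans/(_ (le_lt_trans (ge0_subset_integral mu (mE n)
    measurableT mh1 (fun x _ => abse_ge0 _) (@subsetT _ _)) hoo)) muE.
  move: muE; rewrite !ltNge !leye_eq; apply: contraNN => /eqP ->.
  by rewrite gt0_muley// lte_fin.
pose f n x := ((fun x => `|h x|%:E) \_ (~` E n)) x.
have mf n : measurable_fun setT (f n).
  apply/(measurable_restrictT _ (measurableC (mE n))).
  by apply: measurable_funTS; exact/measurable_EFinP.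
have f0 x : f n x @[n --> \oo] --> 0%E.
  (* At a point where h does not vanish, f n x is 0 as soon as n exceeds both
     |h x| and its inverse. *)
  have [N EN] : exists N, forall n, (N <= n)%N -> E n x \/ h x = 0.
    have [h0|h0] := eqVneq (h x) 0; first by exists 0%N => n _; right.
    exists (maxn (Num.trunc `|h x|^-1) (Num.trunc `|h x|)) => n.
    rewrite geq_max => /andP[n1 n2]; left; apply/andP; split.
      rewrite invf_ple ?posrE ?ltr0n ?normr_gt0//.
      by rewrite (le_trans (ltW (truncnS_gt _)))// ler_nat.
    by rewrite (le_trans (ltW (truncnS_gt _)))// ler_nat.
  apply: cvg_near_cst; exists N => // n /= Nn; rewrite /f patchE.
  have [nE|//] := boolP (x \in ~` E n).
  case: (EN _ Nn) => [Ex|->]; last by rewrite normr0.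
  by move: nE; rewrite inE => /(_ Ex).
have dom x n : (`|f n x| <= `|(EFin \o h) x|)%E.
  by rewrite /f patchE; case: ifPn => // _; rewrite ?abse0//= normr_id.
have [_ _] := @dominated_convergence _ _ _ mu setT measurableT f (cst 0%E)
  (fun x => `|(EFin \o h) x|)%E mf (measurable_cst _) (aeW _ (fun x _ => f0 x))
  (integrable_abse ih) (aeW _ (fun x n _ => dom x n)).
rewrite integral0 => /fine_cvgP[fin] /cvgrPdist_lt/(_ e e0) small.
have [N [Nfin Nlt]] := filter_ex (filterI fin small).
exists (E N), N.+1%:R; split => //; first by move=> x /andP[].
rewrite integral_mkcond -/(f N) -[ltLHS](fineK Nfin) lte_fin.
by move: Nlt; rewrite /= sub0r normrN; exact/le_lt_trans/ler_norm.
Qed.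

(** * The L^1 norm and convergence in measure *)

Lemma ge0_integral_le_cst d (T : measurableType d) (R : realType)
    (mu : {measure set T -> \bar R}) (A : set T) (w : T -> \bar R) (c : \bar R) :
  measurable A -> measurable_fun A w -> (forall x, A x -> 0 <= w x)%E ->
  (forall x, A x -> w x <= c)%E -> (\int[mu]_(x in A) w x <= c * mu A)%E.
Proof.
move=> mA mw w0 wc; by rewrite -integral_cst//; exact: ge0_le_integral.
Qed.

Section L1.
Context d (T : measurableType d) (R : realType).
Variable mu : {measure set T -> \bar R}.
Implicit Types f g y : L1 mu.

Lemma measurable_L1_fun f : measurable_fun setT (L1_fun f).
Proof. exact: (@measurable_funPT _ _ _ _ (L1_repr f)). Qed.

Lemma measurable_L1_dist f g :
  measurable_fun setT (fun x => `|L1_fun f x - L1_fun g x|).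
Proof.
apply: measurableT_comp => //.
by apply: measurable_funB; exact: measurable_L1_fun.
Qed.

Lemma L1_norm_EFin f : (`|f|%:E = \int[mu]_x `|L1_fun f x|%:E)%E.
Proof.
rewrite L1_normE fineK// ge0_fin_numE ?integral_ge0//.
have := Lfunction_finite (lexx _) (L1_repr f).
by rewrite /finite_norm Lnorm1.
Qed.

Lemma L1_distE f g : (`|f - g|%:E = \int[mu]_x `|L1_fun f x - L1_fun g x|%:E)%E.
Proof.
rewrite L1_norm_EFin; apply: ae_eq_integral => //.
- apply/measurable_EFinP/measurableT_comp => //; exact: measurable_L1_fun.
- by apply/measurable_EFinP; exact: measurable_L1_dist.
- have fg := L1_piE (L1_repr f + L1_repr (- g)).
  have gN := L1_piE (- L1_repr g).
  apply: filterS2 fg gN => x /(_ I) fgx /(_ I) gNx _; congr (`|_|%:E).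
  by rewrite [LHS]fgx; congr (_ + _); exact: gNx.
Qed.

Lemma integrable_L1_sub f g :
  mu.-integrable setT (EFin \o (fun x => L1_fun f x - L1_fun g x)).
Proof.
apply/integrableP; split.
  by apply/measurable_EFinP/measurable_funB; exact: measurable_L1_fun.
by rewrite -L1_distE ltry.
Qed.

(** The functions min(|h|, |f - y|) are dominated by |h|, which reduces the claim
to a set E of finite measure on which |h| <= M. There the integrand is at most M
on the part where |f - y| > r, of measure less than r, and at most r elsewhere. *)
Lemma near_meas_min_lt h f (e : R) : mu.-integrable setT (EFin \o h) -> 0 < e ->
  \forall y \near (f : L1_meas mu),
    (\int[mu]_x (Num.min `|h x| `|L1_fun f x - L1_fun y x|)%:E < e%:E)%E.
Proof.
move=> ih e0.
have [|E [M [mE Eoo M0 hM tailE]]] := @integrable_tail _ _ _ mu h (e / 2) ih.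
  by rewrite divr_gt0.
have /measurable_EFinP mh := measurable_int _ ih.
have Efin : mu E \is a fin_num by rewrite ge0_fin_numE.
pose m := fine (mu E).
have m0 : 0 <= m by exact: fine_ge0.
(* Any r > 0 with (mu E + M) r < e / 2 would do. *)
pose r := e / (2 * (m + M + 1)).
have r0 : 0 < r by rewrite divr_gt0//; lra.
have rmM : (m + M) * r < e / 2.
  have -> : (m + M) * r = e / 2 * ((m + M) / (m + M + 1)).
    by rewrite /r; field; lra.
  by rewrite gtr_pMr ?divr_gt0// ltr_pdivrMr; lra.
have entU : entourage (meas_entourage_base (E, r) : set (L1_meas mu * L1_meas mu)).
  by exists (E, r).
apply: filterS (nbhs_entourage (f : L1_meas mu) entU) => y /xsectionP.
rewrite /meas_entourage_base/=; set D := dev_set f y E r => Dr.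
pose w x := (Num.min `|h x| `|L1_fun f x - L1_fun y x|)%:E.
have w0 x : (0 <= w x)%E by rewrite lee_fin le_min !normr_ge0.
have mw : measurable_fun setT w.
  apply/measurable_EFinP/measurable_minr; last exact: measurable_L1_dist.
  exact: measurableT_comp.
have mD : measurable D by exact: measurable_dev_set.
have ED : E = D `|` (E `\` D) by rewrite setDUK// => x [].
have mED : measurable (E `\` D) by exact: measurableD.
have wD : (\int[mu]_(x in D) w x <= M%:E * r%:E)%E.
  apply: (@le_trans _ _ (M%:E * mu D)%E); last by rewrite lee_wpmul2l ?lee_fin// ltW.
  apply: ge0_integral_le_cst => //; first exact: measurable_funTS.
  by move=> x [Ex _]; rewrite lee_fin ge_min hM.
have wED : (\int[mu]_(x in E `\` D) w x <= r%:E * m%:E)%E.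
  apply: (@le_trans _ _ (r%:E * mu (E `\` D))%E).
    apply: ge0_integral_le_cst => //; first exact: measurable_funTS.
    move=> x [Ex nDx]; rewrite lee_fin ge_min orbC leNgt; apply/orP; left.
    by apply/negP => rx; apply: nDx.
  rewrite lee_wpmul2l ?lee_fin ?(ltW r0)// fineK//.
  by apply: le_measure; rewrite ?inE//; exact: subDsetl.
have wC : (\int[mu]_(x in ~` E) w x <= \int[mu]_(x in ~` E) `|h x|%:E)%E.
  apply: ge0_le_integral => //; first exact: measurableC.
  - exact: measurable_funTS.
  - by apply/measurable_EFinP/measurableT_comp => //; exact: measurable_funTS.
  - by move=> x _; rewrite lee_fin ge_min lexx.
have wE : (\int[mu]_(x in E) w x =
    \int[mu]_(x in D) w x + \int[mu]_(x in E `\` D) w x)%E.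
  rewrite {1}ED ge0_integral_setU//; first by rewrite -ED; exact: measurable_funTS.
  by apply/disj_setPS => x [Dx [_ /(_ Dx)]].
rewrite -(setUv E) ge0_integral_setU//; last 3 first.
- exact: measurableC.
- exact: measurable_funTS.
- by apply/disj_setPCl.
rewrite wE [e]splitr EFinD; apply: lteD; last exact: le_lt_trans wC tailE.
rewrite (le_lt_trans (leeD wD wED))// -!EFinM -EFinD lte_fin.
by rewrite (_ : _ + _ = (m + M) * r)//; ring.
Qed.

(** The triangle inequality |y - g| <= |f - g| + |f - y| is almost an equality in
L^1 when f - g and f - y overlap little, which min(|f - g|, |f - y|) measures. *)
Lemma L1_dist_defect f g y :
  (`|f - g|%:E + `|f - y|%:E <= `|y - g|%:E +
   2%:E * \int[mu]_x (Num.min `|L1_fun f x - L1_fun g x|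
                              `|L1_fun f x - L1_fun y x|)%:E)%E.
Proof.
have mdist (a b : L1 mu) :
    measurable_fun setT (fun x => (`|L1_fun a x - L1_fun b x|)%:E).
  by apply/measurable_EFinP; exact: measurable_L1_dist.
have mmin : measurable_fun setT (fun x => (Num.min `|L1_fun f x - L1_fun g x|
    `|L1_fun f x - L1_fun y x|)%:E).
  by apply/measurable_EFinP/measurable_minr; exact: measurable_L1_dist.
have min0 x : (0 <= (Num.min `|L1_fun f x - L1_fun g x|
    `|L1_fun f x - L1_fun y x|)%:E)%E by rewrite lee_fin le_min !normr_ge0.
rewrite !L1_distE -ge0_integralZl_EFin// -!ge0_integralD//; last exact: measurable_funeM.
apply: ge0_le_integral => //.
- by move=> x _; rewrite adde_ge0.
- exact: emeasurable_funD.
- by apply: emeasurable_funD => //; exact: measurable_funeM.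
move=> x _; rewrite -EFinM -!EFinD lee_fin.
move: (L1_fun f x) (L1_fun g x) (L1_fun y x) => a b c.
have ab := ler_distD c a b; have ac := ler_distD b a c.
rewrite (distrC b c) in ac.
by case: (leP `|a - b| `|a - c|) => _; lra.
Qed.
End L1.

(** * The fixed point *)

Theorem theorem4p12 (d : measure_display) (Omega : measurableType d)
    (R : realType) (mu : {sigma_finite_measure set Omega -> \bar R})
    (K : set (L1 mu))
    (K_nonempty : K !=set0)
    (K_bounded : bounded_set K)
    (K_closed : closed K)
    (K_convex : convex_set K)
    (K_compact : measure_compact K)
    (T : L1 mu -> L1 mu)
    (T_K : set_fun K K T)
    (T_nonexpansive : forall x y : L1 mu, K x -> K y ->
       `|T x - T y| <= `|x - y|) :
  exists2 x : L1 mu, K x & T x = x.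
Proof.
have approx e : 0 < e -> exists2 x, K x & `|T x - x| < e.
  exact: approx_fixed_point.
(* Every neighbourhood, for convergence in measure, of a cluster point of F
   contains approximate fixed points of any given precision. *)
pose F : set_system (L1_meas mu) :=
  filter_from [set e : R | 0 < e] (fun e => [set x | K x /\ `|T x - x| < e]).
have FF : ProperFilter F.
  apply: filter_from_proper; last first.
    by move=> e /approx[x Kx xe]; exists x.
  apply: filter_from_filter; first by exists 1 => /=.
  move=> a b a0 b0; exists (Num.min a b); first by rewrite /= lt_min a0.
  by move=> x [Kx]; rewrite lt_min => /andP[].
have FK : F K by exists 1 => //= x [].
have [f [Kf clf]] := K_compact F FF FK.
exists f => //; apply/eqP; rewrite -subr_eq0 -normr_le0.
apply/ler_addgt0Pr => e e0; rewrite add0r.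
have e4 : 0 < e / 4 by rewrite divr_gt0.
have [y [[Ky yT] fy]] := clf _ _ (ex_intro2 _ _ (e / 4) e4 (@subset_refl _ _))
  (near_meas_min_lt f (integrable_L1_sub f (T f)) e4).
have TfTy : `|y - T f| <= `|T y - y| + `|f - y|.
  rewrite (le_trans (ler_distD (T y) _ _))// distrC lerD2l.
  by rewrite [leRHS]distrC; exact: T_nonexpansive.
have : `|f - T f| + `|f - y| <= `|y - T f| + 2 * (e / 4).
  rewrite -lee_fin !EFinD EFinM (le_trans (L1_dist_defect f (T f) y))//.
  by rewrite leeD2l// lee_wpmul2l// ltW.
rewrite (distrC f (T f)); lra.
Qed.
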